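(* Let $G$ be a finite group and let $S$ be a set of generators of $G$ with $e\in S=S^{-1}$. Suppose that $G$ acts transitively on a finite set $V$, and let $\mathfrak{X}_S$ be the configuration coming from the Schreier graph $\mathrm{Sch}(V,S)$. Then the number $WL(\mathfrak{X}_S)$ of nontrivial iterations of the Weisfeiler-Leman algorithm applied to $\mathfrak{X}_S$ satisfies $$WL(\mathfrak{X}_S)\leq \log_2 \mathrm{diam}\,\mathrm{Sch}(V,S)+3 .$$
   Context: The Schreier graph $\mathrm{Sch}(V,S)$ has vertex set $V$ and (multi)edge set $\{(v,sv): v\in V, s\in S\}$; its diameter is the maximum over ordered pairs of vertices of the length of a shortest directed path between them (finite since $S$ generates $G$ and the action is transitive). The configuration $\mathfrak{X}_S$ is the pair $(V,c)$ with colouring $c:V^2\to\mathcal{P}(S)$, $c(v_1,v_2)=\{s\in S: sv_1=v_2\}$. Weisfeiler-Leman algorithm: for a set $\Gamma$ with colouring $c:\Gamma^2\to\mathcal{C}$, put $c^{(0)}=c$, $\mathcal{C}^{(0)}=\mathcal{C}$, and define $c^{(h+1)}(v_1,v_2)$ to be the tuple consisting of $c^{(h)}(v_1,v_2)$ together with the family of numbers $\left|\{w\in\Gamma: c^{(h)}(v_1,w)=c_1,\ c^{(h)}(w,v_2)=c_2\}\right|$ indexed by $(c_1,c_2)\in\mathcal{C}^{(h)}\times\mathcal{C}^{(h)}$; $\mathcal{C}^{(h+1)}$ is the set of values of $c^{(h+1)}$. Each $c^{(h+1)}$ refines $c^{(h)}$. The number of nontrivial iterations $WL$ is the least $h\geq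 0$ such that the partition of $\Gamma^2$ into colour classes of $c^{(h+1)}$ equals that of $c^{(h)}$ (i.e. the final iteration producing no refinement is not counted). *)

(* Defs.v *)
From HB Require Import structures.
From mathcomp Require Import all_boot all_fingroup.

Set Implicit Arguments.
Unset Strict Implicit.
Unset Printing Implicit Defensive.

Section WeisfeilerLeman.

Variable V : finType.

Record configuration := Configuration {
  colour : finType;
  col : V -> V -> colour
}.

Definition wl_tuple (X : configuration) (v1 v2 : V) :
    colour X * {ffun colour X * colour X -> nat} :=
  (col X v1 v2,
   [ffun c => #|[set w | (col X v1 w == c.1) && (col X w v2 == c.2)]|]).

Definition wl_values (X : configuration) :
    seq (colour X * {ffun colour X * colour X -> nat}) :=
  codom (fun p : V * V => wl_tuple X p.1 p.2).

Definition wl_refine (X : configuration) : configuration :=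
  @Configuration (seq_sub (wl_values X))
    (fun v1 v2 => SeqSub (codom_f (fun p => wl_tuple X p.1 p.2) (v1, v2))).

Definition wl_iter (h : nat) (X : configuration) : configuration :=
  iter h wl_refine X.

Definition colour_classes (X : configuration) : {set {set V * V}} :=
  preim_partition (fun p => col X p.1 p.2) [set: V * V].

Definition wl_stable (X : configuration) (h : nat) : bool :=
  colour_classes (wl_iter h.+1 X) == colour_classes (wl_iter h X).

Lemma wl_refineP (X : configuration) (p q : V * V) :
  col (wl_refine X) p.1 p.2 = col (wl_refine X) q.1 q.2 ->
  col X p.1 p.2 = col X q.1 q.2.
Proof. by move=> /(congr1 val) /= [->]. Qed.

Lemma wl_stable_ex (X : configuration) : exists h, wl_stable X h.
Proof.
pose E (Y : configuration) : {set (V * V) * (V * V)} :=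
  [set pq | col Y pq.1.1 pq.1.2 == col Y pq.2.1 pq.2.2].
have Esub Y : E (wl_refine Y) \subset E Y.
  by apply/subsetP=> pq; rewrite !inE => /eqP /wl_refineP ->.
have Eeq Y Z : E Y = E Z -> colour_classes Y = colour_classes Z.
  move=> eqE; apply: eq_imset => p; apply/setP=> q; rewrite !inE /=.
  by have /setP/(_ (p, q)) := eqE; rewrite !inE.
suff main n Y : #|E Y| <= n -> exists h, wl_stable Y h by exact: main (leqnn _).
elim: n Y => [|n IHn] Y leYn.
  exists 0; apply/eqP/Eeq/eqP; rewrite eqEcard Esub.
  exact: leq_trans leYn _.
have [eqE|ltE] := eqVproper (Esub Y); first by exists 0; apply/eqP/Eeq.
have [h sth] := IHn (wl_refine Y) (leq_trans (proper_card ltE) leYn).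
by exists h.+1; rewrite /wl_stable /wl_iter !iterSr in sth *.
Qed.

Definition WL (X : configuration) : nat := ex_minn (wl_stable_ex X).

End WeisfeilerLeman.

Section Diameter.

Variables (V : finType) (e : rel V).

Definition walk_of_length (v w : V) (n : nat) : bool :=
  [exists p : n.-tuple V, path e v p && (last v p == w)].

(* The search is bounded by #|V|, which a shortest path never exceeds; the    *)
(* value is #|V| when w is not reachable from v.                              *)
Definition distance (v w : V) : nat :=
  [arg min_(n < (ord_max : 'I_#|V|.+1) | walk_of_length v w n) n].

Definition diameter : nat := \max_(p : V * V) distance p.1 p.2.

Lemma walk_of_lengthP (v w : V) (n : nat) :
  reflect (exists p, [/\ path e v p, last v p = w & size p = n])
          (walk_of_length v w n).
Proof.
apply: (iffP existsP) => [[p /andP[ep /eqP lp]]|[p [ep lp /eqP sp]]].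
  by exists p; rewrite size_tuple.
by exists (Tuple sp); rewrite /= ep lp eqxx.
Qed.

Lemma distanceP (v w : V) : connect e v w ->
  walk_of_length v w (distance v w) /\
  (forall n, walk_of_length v w n -> distance v w <= n).
Proof.
have short p : path e v p -> last v p = w ->
    exists2 n : 'I_#|V|.+1, walk_of_length v w n & n <= size p.
  move=> ep; case/shortenP: ep => q ep uq sub lp.
  have ltq : size q < #|V|.+1.
    by rewrite ltnS; apply/ltnW/(leq_trans _ (max_card (mem (v :: q))));
       rewrite (card_uniqP uq).
  exists (Ordinal ltq); first by apply/walk_of_lengthP; exists q.
  by rewrite uniq_leq_size //; case/andP: uq.
case/connectP=> p ep lp; have [n0 wn0 _] := short p ep (esym lp).
rewrite /distance /arg_min /extremum; case: pickP => [m|none].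
  case/andP=> wm /forallP minm; split=> // n /walk_of_lengthP[q [eq_ lq <-]].
  have [k wk] := short q eq_ lq; apply: leq_trans.
  by have /implyP := minm k; apply.
have [m wm minm] := @arg_minnP _ n0 (fun n : 'I_#|V|.+1 => walk_of_length v w n)
  (fun n => n : nat) wn0.
have /negP[] := negbT (none m); rewrite /= wm /=.
by apply/forallP=> k; apply/implyP=> wk; apply: minm.
Qed.

End Diameter.

Section Schreier.

Variables (gT : finGroupType) (G : {group gT}) (V : finType).
Variables (to : action G V) (S : {set gT}).

(* Actions in MathComp are right actions: the left action of G that            *)
(* corresponds to [to] is s v = to v s^-1.                                     *)
Definition lact (s : gT) (v : V) : V := to v s^-1%g.

Definition schreier_edge : rel V :=
  [rel v w | [exists s in S, lact s v == w]].

Definition schreier_configuration : configuration V :=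
  @Configuration V {set gT} (fun v1 v2 => [set s in S | lact s v1 == v2]).

End Schreier.

(* Main.v *)
Require Import Defs.
From HB Require Import structures.
From mathcomp Require Import all_boot all_order all_fingroup all_algebra.
From mathcomp Require Import reals exp.

(** After [h] iterations the colour of [(v, w)] determines which products of
    [2 ^ h] elements of [S] carry [v] to [w]. Let [d] be the diameter. By
    Schreier's lemma the stabiliser of [v] is generated by the products of
    [2 d + 1] generators that fix [v]. Hence, once [2 ^ h > 2 d], if [(v, w)]
    and [(v', w')] have the same colour after [h + 1] iterations, then the
    stabiliser of [v] fixes [v'], so that there is an equivariant permutation of
    [V] sending [v] to [v'], and it sends [w] to [w']. Equivariant permutations
    preserve the colours of all iterations, so there is no further refinement. *)

Set Implicit Arguments.
Unset Strict Implicit.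
Unset Printing Implicit Defensive.

Import GroupScope.

(* [matrix.col] shadows [Defs.col]. *)
Local Notation col := Defs.col.

Section Refinement.

Variable V : finType.
Implicit Types (X : configuration V) (f g : V -> V) (p : {perm V}).

Definition is_automorphism X p : Prop :=
  forall v w, col X (p v) (p w) = col X v w.

Definition recognizes X f : Prop :=
  forall v w v' w', col X v w = col X v' w' -> f v = w -> f v' = w'.

Lemma wl_refine_split X v w v' w' u :
  col (wl_refine X) v w = col (wl_refine X) v' w' ->
  exists2 u', col X v u = col X v' u' & col X u w = col X u' w'.
Proof.
move=> /(congr1 val) [_ /ffunP/(_ (col X v u, col X u w))]; rewrite !ffunE /=.
set B := [set _ | _]; set B' := [set _ | _] => eq_card_BB'.
have /card_gt0P[u'] : 0 < #|B'|.
  by rewrite -eq_card_BB'; apply/card_gt0P; exists u; rewrite inE !eqxx.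
by rewrite inE => /andP[/eqP eq_vu /eqP eq_uw]; exists u'.
Qed.

Lemma recognizes_comp X f g :
  recognizes X f -> recognizes X g -> recognizes (wl_refine X) (g \o f).
Proof.
move=> recf recg v w v' w' /(wl_refine_split (f v))[u' eq_vu eq_uw] /= gfv.
by rewrite (recf _ _ _ _ eq_vu erefl); apply: recg eq_uw gfv.
Qed.

Lemma wl_refine_diag X v w v' w' : recognizes X id ->
  col (wl_refine X) v w = col (wl_refine X) v' w' -> col X v v = col X v' v'.
Proof.
move=> rec_id /(wl_refine_split v)[u' eqc _].
by rewrite {2}(rec_id _ _ _ _ eqc).
Qed.

Lemma is_automorphism_refine X p :
  is_automorphism X p -> is_automorphism (wl_refine X) p.
Proof.
move=> pX v w; apply: val_inj; congr (_, _); first exact: pX.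
apply/ffunP=> c; rewrite !ffunE -[RHS](card_imset _ (@perm_inj _ p)).
apply: eq_card => u; rewrite -[u](permKV p) mem_imset; last exact: perm_inj.
by rewrite !inE !pX.
Qed.

Lemma is_automorphism_iter X p h :
  is_automorphism X p -> is_automorphism (wl_iter h X) p.
Proof. by move=> pX; elim: h => // h; apply: is_automorphism_refine. Qed.

Lemma WL_leq X h : wl_stable X h -> WL X <= h.
Proof. by rewrite /WL; case: ex_minnP => n _; apply. Qed.

Lemma WL_leq_automorphism X h :
    (forall v w v' w', col (wl_iter h X) v w = col (wl_iter h X) v' w' ->
       exists2 p, is_automorphism X p & p v = v' /\ p w = w') ->
  WL X <= h.
Proof.
move=> autX; apply: WL_leq; apply/eqP/eq_imset => -[v w]; apply/setP=> -[v' w'].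
rewrite !inE /=; apply/eqP/eqP => [|/autX[p pX [<- <-]]].
  exact: (@wl_refineP _ (wl_iter h X) (v, w) (v', w')).
by apply/esym/(is_automorphism_iter h.+1 pX).
Qed.

End Refinement.

Section Walks.

Variables (V : finType) (e : rel V).

Lemma walk_of_length0 v w : walk_of_length e v w 0 = (v == w).
Proof.
apply/walk_of_lengthP/eqP => [[[|? ?] [] //]|<-].
by exists [::].
Qed.

Lemma walk_of_lengthS v w n :
  walk_of_length e v w n.+1 = [exists u, e v u && walk_of_length e u w n].
Proof.
apply/walk_of_lengthP/existsP => [[[|u p] [] //= /andP[vu up] lastp [sizep]]|].
  by exists u; rewrite vu; apply/walk_of_lengthP; exists p.
case=> u /andP[vu /walk_of_lengthP[p [up lastp sizep]]].
by exists (u :: p); rewrite /= vu sizep.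
Qed.

Lemma walk_of_length_connect v w n : walk_of_length e v w n -> connect e v w.
Proof. by case/walk_of_lengthP=> p [vp lastp _]; apply/connectP; exists p. Qed.

Lemma connect_leq_diameter v w : connect e v w ->
  exists2 n, n <= diameter e & walk_of_length e v w n.
Proof.
case/distanceP=> walk_vw _; exists (distance e v w) => //.
exact: (leq_bigmax (F := fun p => distance e p.1 p.2) (v, w)).
Qed.

End Walks.

Section SetPowers.

Variable gT : finGroupType.
Implicit Types (A : {set gT}) (G H : {group gT}).

Lemma expgs_subG A G n : A \subset G -> A ^+ n \subset G.
Proof.
by move=> sAG; elim: n => [|n IHn]; rewrite ?sub1G // expgS mul_subG.
Qed.

Lemma leq_expgs A m n : 1 \in A -> m <= n -> A ^+ m \subset A ^+ n.
Proof.
move=> A1 /subnK <-; elim: (n - m) => [|k IHk] //.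
by rewrite addSn expgS (subset_trans IHk) ?mulg_subr.
Qed.

Lemma expgs1 A n : 1 \in A -> 1 \in A ^+ n.
Proof. by move=> A1; rewrite -sub1set -set1gE -[1](expg0 A) leq_expgs. Qed.

Lemma gen_eq_expgs A : 1 \in A -> exists n, <<A>> = A ^+ n.
Proof.
move=> A1; have [n ->] := gen_expgs A; exists n.
by rewrite (setUidPr _) ?sub1set.
Qed.

(* Schreier's lemma for a transversal of [H] contained in [A ^+ d]. *)
Lemma gen_setI_expgs A H d :
    1 \in A -> A^-1 = A -> H \subset <<A>> -> <<A>> \subset H * A ^+ d ->
  <<H :&: A ^+ d.*2.+1>> = H.
Proof.
move=> A1 AV sHA sAHd; set K := <<_>>.
have sKH : K \subset H by rewrite gen_subG subsetIl.
have sAdS : A ^+ d.+1 \subset K * A ^+ d.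
  apply/subsetP=> g gA.
  have genA_g := subsetP (expgs_subG d.+1 (subset_gen A)) g gA.
  have /mulsgP[h t hH tA defg] := subsetP sAHd g genA_g.
  rewrite defg mem_mulg // mem_gen // inE hH -(mulgK t h) -defg.
  by rewrite -addnn -addSn expgnDr mem_mulg // -AV expVgn inE invgK.
have sAK n : A ^+ n \subset K * A ^+ d.
  elim: n => [|n IHn].
    by rewrite sub1set -[1]mulg1 mem_mulg ?group1 ?expgs1.
  rewrite expgSr (subset_trans (mulSg A IHn)) // -mulgA -expgSr.
  by rewrite (subset_trans (mulgS K sAdS)) // mulgA mulGid.
have [n defA] := gen_eq_expgs A1.
have sHKA : H \subset K * A ^+ d by rewrite (subset_trans sHA) // defA.
have defH : K * (A ^+ d :&: H) = H by rewrite group_modl // (setIidPr sHKA).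
apply/eqP; rewrite eqEsubset sKH -{1}defH mul_subG // sub_gen // setIC setIS //.
by rewrite leq_expgs // -addnn leqW ?leq_addr.
Qed.

End SetPowers.

Section Actions.

Variables (aT : finGroupType) (G : {group aT}) (rT : finType).
Variable to : action G rT.
Implicit Types (x y : rT) (A B S : {set aT}).

Lemma mem_astab1 a x : a \in G -> (a \in 'C[x | to]) = (to x a == x).
Proof. by move=> aG; rewrite !inE aG sub1set inE. Qed.

Lemma orbitM A B x : A \subset G -> B \subset G ->
  orbit to (A * B) x = \bigcup_(y in orbit to A x) orbit to B y.
Proof.
move=> /subsetP sAG /subsetP sBG; apply/setP=> z; apply/orbitP/bigcupP.
  case=> _ /mulsgP[a b aA bB ->] <-; exists (to x a); first exact: mem_orbit.
  by rewrite actMin ?(sAG a) ?(sBG b) ?mem_orbit.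
case=> _ /orbitP[a aA <-] /orbitP[b bB <-].
by exists (a * b); rewrite ?mem_mulg // actMin ?(sAG a) ?(sBG b).
Qed.

Lemma astab1_gen_expgs S d x :
    1 \in S -> S^-1 = S -> <<S>> = G -> orbit to (S ^+ d) x = [set: rT] ->
  <<'C_(S ^+ d.*2.+1)[x | to]>> = 'C[x | to].
Proof.
move=> S1 SV genS orbit_d; rewrite setIC; apply: gen_setI_expgs => //.
  by rewrite genS subsetIl.
apply/subsetP=> g; rewrite genS => gG.
have /orbitP[t tS tx] : to x g \in orbit to (S ^+ d) x by rewrite orbit_d.
have tG : t \in G by rewrite -genS (subsetP (expgs_subG d (subset_gen S))).
rewrite -(mulgKV t g) mem_mulg // mem_astab1 ?groupM ?groupV //.
by rewrite actMin ?groupV // -tx actKin.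
Qed.

Lemma transitive_equivariant_perm x y :
    [transitive G, on [set: rT] | to] -> 'C[x | to] \subset 'C[y | to] ->
  exists2 p : {perm rT}, p x = y & {in G, forall a z, p (to z a) = to (p z) a}.
Proof.
move=> transG sCxy.
have reach u v : exists2 a, a \in G & to u a = v.
  by have [] := @atransP2in _ _ _ to G setT _ transG u v => // a; exists a.
have /fin_all_exists2[t tG tx] := reach x.
pose f z := to y (t z).
have f_act a : a \in G -> f (to x a) = to y a.
  move=> aG; have : t (to x a) * a^-1 \in 'C[y | to].
    apply: (subsetP sCxy).
    by rewrite mem_astab1 ?groupM ?groupV // actMin ?groupV // tx actKin.
  rewrite mem_astab1 ?groupM ?groupV // actMin ?groupV // => /eqP fix_y.
  by rewrite -[in RHS]fix_y actKVin.
have /fin_all_exists[f' fK] z : exists z', f z' = z.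
  by have [a aG <-] := reach y z; exists (to x a); apply: f_act.
have f_inj : injective f by apply: can_inj (canF_sym fK).
exists (perm f_inj) => [|a aG z]; rewrite !permE.
  by rewrite -[x in f x](act1 to) f_act ?act1.
by rewrite -[z in LHS]tx -actMin // f_act ?groupM // actMin.
Qed.

End Actions.

Section SchreierGraph.

Variables (gT : finGroupType) (G : {group gT}) (S : {set gT}).
Variables (V : finType) (to : action G V).
Hypothesis sSG : S \subset G.

Local Notation X := (schreier_configuration to S).
Local Notation edge := (schreier_edge to S).

Let sVG : S^-1 \subset G. Proof. by rewrite -invGid invSg. Qed.

Let sVnG n : S^-1 ^+ n \subset G. Proof. exact: expgs_subG. Qed.

Lemma schreier_edgeE v w : edge v w = (w \in orbit to S^-1 v).
Proof.
apply/existsP/orbitP => [[s /andP[sS /eqP <-]]|[s sS <-]].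
  by exists s^-1; rewrite // inE invgK.
by exists s^-1; rewrite /lact invgK eqxx andbT -mem_invg.
Qed.

Lemma schreier_walkE v w n :
  walk_of_length edge v w n = (w \in orbit to (S^-1 ^+ n) v).
Proof.
elim: n v => [|n IHn] v.
  by rewrite walk_of_length0 expg0 orbitE set1gE imset_set1 act1 inE eq_sym.
rewrite walk_of_lengthS expgS orbitM //.
apply/existsP/bigcupP => [[u /andP[]]|[u]].
  by rewrite schreier_edgeE IHn; exists u.
by move=> vu uw; exists u; rewrite schreier_edgeE IHn vu.
Qed.

Lemma recognizes_expgs h g :
  g \in S^-1 ^+ (2 ^ h) -> recognizes (wl_iter h X) (to^~ g).
Proof.
elim: h g => [|h IHh] g.
  rewrite expg1 inE => gS v w v' w' /setP/(_ g^-1).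
  by rewrite !inE gS /lact invgK /= => eqc /eqP; rewrite eqc => /eqP.
rewrite expnS mul2n -addnn expgnDr => /mulsgP[a b aS bS ->] v w v' w' eqc.
have aG := subsetP (sVnG _) a aS; have bG := subsetP (sVnG _) b bS.
by rewrite !actMin //; apply: recognizes_comp (IHh a aS) (IHh b bS) _ _ _ _ eqc.
Qed.

Lemma equivariant_is_automorphism (p : {perm V}) :
  {in G, forall a v, p (to v a) = to (p v) a} -> is_automorphism X p.
Proof.
move=> pG v w; apply/setP=> s; rewrite !inE; have [sS|//] := boolP (s \in S).
by rewrite /lact -pG ?groupV ?(subsetP sSG) // (inj_eq perm_inj).
Qed.

End SchreierGraph.

Section SchreierWL.

Variables (gT : finGroupType) (G : {group gT}) (S : {set gT}).
Variables (V : finType) (to : action G V).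
Hypotheses (genS : <<S>> = G) (S1 : 1 \in S) (SV : S^-1 = S).
Hypothesis transG : [transitive G, on [set: V] | to].

Local Notation X := (schreier_configuration to S).
Local Notation d := (diameter (schreier_edge to S)).

Let sSG : S \subset G. Proof. by rewrite -genS subset_gen. Qed.

Lemma orbit_expgs_diameter v : orbit to (S ^+ d) v = [set: V].
Proof.
apply/setP=> w; rewrite [RHS]inE.
have [n] := gen_eq_expgs S1; rewrite genS => defG.
have /connect_leq_diameter[m le_md] : connect (schreier_edge to S) v w.
  apply: (@walk_of_length_connect _ _ _ _ n).
  by rewrite schreier_walkE // SV -defG (atransPin _ transG) ?inE.
rewrite schreier_walkE // SV; apply/subsetP.
by rewrite imsetS // leq_expgs.
Qed.

Lemma recognizes_leq_expgs h n g :
  n <= 2 ^ h -> g \in S ^+ n -> recognizes (wl_iter h X) (to^~ g).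
Proof.
move=> le_n gS; apply: recognizes_expgs => //.
by rewrite SV (subsetP (leq_expgs S1 le_n)).
Qed.

Lemma sub_astab1_wl_iter h v w v' w' : d.*2 < 2 ^ h ->
    col (wl_iter h.+1 X) v w = col (wl_iter h.+1 X) v' w' ->
  'C[v | to] \subset 'C[v' | to].
Proof.
move=> lt_dh eqc; have rec_id : recognizes (wl_iter h X) id.
  have rec1 := recognizes_leq_expgs (leq0n _) (set11 1).
  by move=> x y x' y' /rec1; rewrite !act1.
rewrite -(astab1_gen_expgs S1 SV genS (orbit_expgs_diameter v)) gen_subG.
apply/subsetP=> g /setIP[gS gv]; have gG := subsetP (expgs_subG _ sSG) g gS.
have eqc_diag := wl_refine_diag rec_id eqc.
rewrite !mem_astab1 // in gv *; apply/eqP.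
exact: recognizes_leq_expgs lt_dh gS _ _ _ _ eqc_diag (eqP gv).
Qed.

Lemma WL_schreier_leq h : d.*2 < 2 ^ h -> WL X <= h.+1.
Proof.
move=> lt_dh; apply: WL_leq_automorphism => v w v' w' eqc.
have sCvv' := sub_astab1_wl_iter lt_dh eqc.
have [p pv pG] := transitive_equivariant_perm transG sCvv'.
exists p; first exact: equivariant_is_automorphism.
have /orbitP[g gS gv] : w \in orbit to (S ^+ d) v.
  by rewrite orbit_expgs_diameter inE.
have gG := subsetP (expgs_subG d sSG) g gS.
have le_dh : d <= 2 ^ h.+1.
  have lt_d : d < 2 ^ h by rewrite (leq_ltn_trans _ lt_dh) // -addnn leq_addr.
  by rewrite (leq_trans (ltnW lt_d)) ?leq_pexp2l.
by rewrite -{1}gv pG // pv (recognizes_leq_expgs le_dh gS eqc gv).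
Qed.

End SchreierWL.

Import Order.TTheory GRing.Theory Num.Theory.

Local Open Scope ring_scope.

Lemma trunc_log_le_ln (R : realType) (p n : nat) : (1 < p)%N ->
  (trunc_log p n)%:R <= ln (n%:R : R) / ln p%:R.
Proof.
move=> p_gt1; have [->|n_gt0] := posnP n.
  by rewrite trunc_log0 ln0 ?mul0r.
have p_gt0 := ltnW p_gt1.
rewrite ler_pdivlMr ?ln_gt0 ?ltr1n // mulr_natl -lnXn ?ltr0n //.
by rewrite ler_ln ?posrE -?natrX ?ltr0n ?expn_gt0 ?p_gt0 // ler_nat trunc_logP.
Qed.

Theorem theorem1 (R : realType) (gT : finGroupType) (G : {group gT})
    (S : {set gT}) (V : finType) (to : action G V)
    (genS : <<S>>%g = G)
    (S1 : 1%g \in S)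
    (SV : S = S^-1%g)
    (transG : [transitive G, on [set: V] | to]) :
  (WL (schreier_configuration to S))%:R
    <= ln ((diameter (schreier_edge to S))%:R : R) / ln 2 + 3.
Proof.
set d := diameter _.
have WL_le : (WL (schreier_configuration to S) <= trunc_log 2 d + 3)%N.
  rewrite addnS; apply: WL_schreier_leq => //.
  by rewrite -/d addn2 expnS mul2n ltn_double trunc_log_ltn.
apply: (@le_trans _ _ (trunc_log 2 d + 3)%:R); first by rewrite ler_nat.
by rewrite natrD lerD2r trunc_log_le_ln.
Qed.
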